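(* Let $\Omega_\theta \subseteq \mathbb{R}^m$ be the parameter space, and for each $\theta \in \Omega_\theta$ let $\mathrm{Pro}_{X;\theta}$ be the probability distribution of the data $X\in\mathbb{R}^n$ when the parameter value is $\theta$. Let $\alpha_0 \in (0,1)$ and let $x \mapsto \Gamma_{\alpha_0}(x) \subseteq \Omega_\theta$ be a $(1-\alpha_0)$ confidence region for $\theta$, i.e. $$\mathrm{Pro}_{X;\theta}\bigl(\{x : \Gamma_{\alpha_0}(x) \ni \theta\}\bigr) \ge 1-\alpha_0 \quad \text{for all } \theta \in \Omega_\theta.$$ Define, for $A \subseteq \Omega_\theta$, $$\mathrm{Bel}_{\Theta;x}(A) = \begin{cases} 1-\alpha_0, & A \supseteq \Gamma_{\alpha_0}(x),\\ 0, & A \not\supseteq \Gamma_{\alpha_0}(x).\end{cases}$$ Then $\mathrm{Bel}_{\Theta;x}$ satisfies the Martin--Liu validity criterion: for every $\theta \in \Omega_\theta$, every $\alpha \in [0,1]$, and every $A \subset \Omega_\theta$ with $A \not\ni \theta$, $$\mathrm{Pro}_{X;\theta}\bigl(\{x : \mathrm{Bel}_{\Theta;x}(A) \ge 1-\alpha\}\bigr) \le \alpha.$$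
   Context: The parameter $\theta$ is a fixed unknown element of $\Omega_\theta$, and $\mathrm{Pro}_{X;\theta}$ is the (aleatory) sampling distribution of the data under $\theta$. A proposition about $\theta$ is identified with a subset $A \subseteq \Omega_\theta$; it is false when $\theta \notin A$. $\mathrm{Bel}_{\Theta;x}(A)$ is the degree of belief assigned to $A$ given data $x$; the one above is the natural assignment of belief made by a confidence region. The events whose probabilities are taken are understood to be measurable. *)

(* Defs.v *)
From HB Require Import structures.
From mathcomp Require Import all_boot all_order all_algebra.
From mathcomp Require Import all_classical all_reals all_analysis.

Set Implicit Arguments.
Unset Strict Implicit.
Unset Printing Implicit Defensive.

Import Order.TTheory GRing.Theory Num.Theory.
Local Open Scope classical_set_scope.
Local Open Scope ring_scope.

(* A sampling model is a family [Pro] of probabilities on the data space [X]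
   indexed by the ambient parameter type [T]; only its values at points of the
   parameter space [Omega : set T] are ever referred to. *)

(* The coverage events are required to be measurable, since a measure takes
   meaningless values on other sets. *)
Definition confidence_region (R : realType) (d : measure_display)
    (X : measurableType d) (T : Type) (Omega : set T)
    (Pro : T -> probability X R) (alpha0 : R) (Gamma : X -> set T) : Prop :=
  (forall x : X, Gamma x `<=` Omega) /\
  (forall theta : T, Omega theta ->
     measurable [set x | Gamma x theta] /\
     ((1 - alpha0)%:E <= Pro theta [set x | Gamma x theta])%E).

Definition confidence_belief (R : realType) (X T : Type) (alpha0 : R)
    (Gamma : X -> set T) (x : X) (A : set T) : R :=
  if `[< Gamma x `<=` A >] then 1 - alpha0 else 0.

(* The bound is asked of every event of the stated form that is measurable;
   [Bel x] need not produce measurable events for all assertions at once. *)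
Definition martin_liu_valid (R : realType) (d : measure_display)
    (X : measurableType d) (T : Type) (Omega : set T)
    (Pro : T -> probability X R) (Bel : X -> set T -> R) : Prop :=
  forall (theta : T) (alpha : R) (A : set T),
    Omega theta -> 0 <= alpha <= 1 -> A `<=` Omega -> ~ A theta ->
    measurable [set x | 1 - alpha <= Bel x A] ->
    (Pro theta [set x | 1 - alpha <= Bel x A]%R <= alpha%:E)%E.

(* Main.v *)
(** Take [theta] outside [A].  A positive belief [Bel x A] forces
    [Gamma x `<=` A], so the region misses [theta], which has probability at
    most [alpha0].  A belief is at most [1 - alpha0], so for [alpha < alpha0]
    the event is empty, and otherwise [alpha0 <= alpha].  Only [alpha = 1], where
    zero belief also counts, is apart, and there the bound is trivial. *)

Require Import Defs.
From mathcomp Require Import all_boot all_order all_algebra.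
From mathcomp Require Import all_classical all_reals all_analysis.

Set Implicit Arguments.
Unset Strict Implicit.
Unset Printing Implicit Defensive.

Import Order.TTheory GRing.Theory Num.Theory.
Local Open Scope classical_set_scope.
Local Open Scope ring_scope.

(** With [alpha < 1] the threshold [1 - alpha] is positive, so the zero branch of the belief cannot
    reach it. *)
Lemma confidence_belief_ge (R : realType) (X T : Type) (alpha0 alpha : R)
    (Gamma : X -> set T) (x : X) (A : set T) :
  alpha < 1 -> 1 - alpha <= confidence_belief alpha0 Gamma x A ->
  Gamma x `<=` A /\ alpha0 <= alpha.
Proof.
move=> alpha_lt1; rewrite /confidence_belief; case: asboolP => [GA|_].
  by rewrite lerD2l lerN2.
by rewrite subr_le0 leNgt alpha_lt1.
Qed.

Lemma confidence_region_miss (R : realType) (d : measure_display)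
    (X : measurableType d) (T : Type) (Omega : set T)
    (Pro : T -> probability X R) (alpha0 : R) (Gamma : X -> set T) (theta : T) :
  confidence_region Omega Pro alpha0 Gamma -> Omega theta ->
  (Pro theta (~` [set x | Gamma x theta]) <= alpha0%:E)%E.
Proof.
move=> [_ cover] /cover[mG covG].
(* Terms may cross an extended-real inequality here because the coverage probability is finite. *)
rewrite probability_setC// leeBlDl ?fin_num_measure//.
by rewrite EFinB leeBlDr in covG.
Qed.

Lemma confidence_belief_valid (R : realType) (d : measure_display)
    (X : measurableType d) (T : Type) (Omega : set T)
    (Pro : T -> probability X R) (alpha0 : R) (Gamma : X -> set T) :
  confidence_region Omega Pro alpha0 Gamma ->
  martin_liu_valid Omega Pro (confidence_belief alpha0 Gamma).
Proof.
move=> region theta alpha A Otheta /andP[alpha_ge0 alpha_le1] _ nAtheta mE.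
have [alpha1|alpha_neq1] := eqVneq alpha 1.
  by rewrite [X in (_ <= X%:E)%E]alpha1; exact: probability_le1.
have alpha_lt1 : alpha < 1 by rewrite lt_neqAle alpha_neq1.
have [alpha0_le|alpha_lt] := leP alpha0 alpha; last first.
  rewrite [X in Pro theta X](_ : _ = set0) ?measure0 ?lee_fin//.
  apply/seteqP; split=> // x /= /(confidence_belief_ge alpha_lt1)[_].
  by rewrite leNgt alpha_lt.
have [mG _] := region.2 theta Otheta.
have := confidence_region_miss region Otheta.
have alpha0_leE : (alpha0%:E <= alpha%:E)%E by rewrite lee_fin.
move=> /le_trans/(_ alpha0_leE); apply: le_trans.
(* Monotonicity needs both sets measurable: the belief event by [mE], the miss event as the
   complement of [mG]. *)
apply: le_measure; rewrite ?inE//; first exact: measurableC.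
move=> x /= /(confidence_belief_ge alpha_lt1)[GA _] Gtheta.
exact/nAtheta/GA.
Qed.

(* n.-tuple R carries the product sigma-algebra of the Borel sets of R, which
   is the Borel sigma-algebra of R^n. *)
Theorem mainTheorem2 (R : realType) (m n : nat) (Omega : set (m.-tuple R))
    (Pro : m.-tuple R -> probability (n.-tuple R) R) (alpha0 : R)
    (halpha0 : 0 < alpha0 < 1) (Gamma : n.-tuple R -> set (m.-tuple R))
    (hGamma : confidence_region Omega Pro alpha0 Gamma) :
  martin_liu_valid Omega Pro (confidence_belief alpha0 Gamma).
Proof. exact: confidence_belief_valid. Qed.
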